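(* Let $\Omega$ be a bounded convex domain in $\mathbf{R}^n$ ($n\ge 1$), let $D:=\Omega\times(0,\infty)$, and let $f$ be a nonnegative function in $\Omega$. Let $u\in C^{2,1}(D)\cap C(\overline{D})$ satisfy $$\partial_t u=\Delta u+f(x)\quad\text{in } D,\qquad u=0\quad\text{on }\partial D.$$ (i) If $f$ is $q$-concave in $\Omega$ for some $q\ge 1$, then $u$ is $\alpha$-parabolically $p$-concave in $\overline{D}$ with $p=q/(1+2q)$ and any $\alpha\ge 1/2$. (ii) If $f$ is a positive constant in $\Omega$, then the function $(x,t)\mapsto\sqrt{u(x,t^{1/\alpha})}$ is concave in $\overline{D}$ for any $\alpha\ge 1/2$.
   Context: Means: for $a,b>0$, $\lambda\in(0,1)$ and $p\in[-\infty,\infty]$, $M_p(a,b;\lambda)=[(1-\lambda)a^p+\lambda b^p]^{1/p}$ if $p\notin\{-\infty,0,\infty\}$, $M_0(a,b;\lambda)=a^{1-\lambda}b^\lambda$, $M_\infty(a,b;\lambda)=\max\{a,b\}$, $M_{-\infty}(a,b;\lambda)=\min\{a,b\}$. For $a,b\ge0$ the same formulas are used if $p\ge 0$, and $M_p(a,b;\lambda)=0$ if $p<0$ and $ab=0$. $p$-concavity: a nonnegative function $v$ on a convex set $K\subset\mathbf{R}^m$ is $p$-concave if $v((1-\lambda)x+\lambda y)\ge M_p(v(x),v(y);\lambda)$ for all $x,y\in K$, $\lambda\in(0,1)$. $\alpha$-parabolic $p$-concavity ($\alpha,p\in[-\infty,\infty]$): a nonnegative function $v$ on a convex cylinder $Q=K\times(0,\infty)$,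 $K\subset\mathbf{R}^n$ convex, is $\alpha$-parabolically $p$-concave if $$v\big((1-\lambda)x_1+\lambda x_2,M_\alpha(t_1,t_2;\lambda)\big)\ge M_p\big(v(x_1,t_1),v(x_2,t_2);\lambda\big)$$ for all $(x_1,t_1),(x_2,t_2)\in Q$ and $\lambda\in(0,1)$; on $\overline D=\overline\Omega\times[0,\infty)$ the same inequality is required for all $(x_1,t_1),(x_2,t_2)\in\overline D$. $\partial D$ is the boundary of $D$ in $\mathbf{R}^{n+1}$, i.e. $(\partial\Omega\times[0,\infty))\cup(\Omega\times\{0\})$, so the boundary condition includes zero initial data. *)

(* Defs.v *)
From HB Require Import structures.
From mathcomp Require Import all_boot all_order all_algebra.
From mathcomp Require Import all_classical all_reals all_analysis.

Set Implicit Arguments.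
Unset Strict Implicit.
Unset Printing Implicit Defensive.

Import Order.TTheory GRing.Theory Num.Theory.
Import numFieldNormedType.Exports.

Local Open Scope classical_set_scope.
Local Open Scope ring_scope.

(* Space-time R^n x R is 'rV[R]_n * R; its sup norm is equivalent to the
   Euclidean one, so open sets, bounded sets, closures and continuity are the
   usual ones. *)

Definition convex_domain (R : realType) (n : nat) (Omega : set 'rV[R]_n) : Prop :=
  [/\ Omega !=set0, open Omega & convex_set Omega].

Definition cylinder (R : realType) (n : nat) (Omega : set 'rV[R]_n) :
    set ('rV[R]_n * R) :=
  Omega `*` [set t | 0 < t].

Definition boundary (T : topologicalType) (A : set T) : set T :=
  closure A `\` interior A.

(* The mean M_p(a, b; l), for a, b >= 0 and 0 < l < 1.  Since 0 `^ r = 0 for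
   r < 0, the value 0 for p < 0 and a * b = 0 has to be forced; for p = -oo it
   is already given by the minimum. *)
Definition pmean (R : realType) (p : \bar R) (a b l : R) : R :=
  match p with
  | r%:E => if r == 0 then a `^ (1 - l) * b `^ l
            else if (r < 0) && (a * b == 0) then 0
            else ((1 - l) * a `^ r + l * b `^ r) `^ r^-1
  | +oo%E => Num.max a b
  | -oo%E => Num.min a b
  end.

Definition pconcave (R : realType) (n : nat) (p : \bar R)
    (K : set 'rV[R]_n) (v : 'rV[R]_n -> R) : Prop :=
  (forall x, K x -> 0 <= v x) /\
  (forall x y l, K x -> K y -> 0 < l < 1 ->
     pmean p (v x) (v y) l <= v ((1 - l) *: x + l *: y)).

Definition parabolically_pconcave (R : realType) (n : nat) (alpha p : \bar R)
    (Q : set ('rV[R]_n * R)) (v : 'rV[R]_n * R -> R) : Prop :=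
  (forall z, Q z -> 0 <= v z) /\
  (forall x1 t1 x2 t2 l, Q (x1, t1) -> Q (x2, t2) -> 0 < l < 1 ->
     pmean p (v (x1, t1)) (v (x2, t2)) l
       <= v ((1 - l) *: x1 + l *: x2, pmean alpha t1 t2 l)).

Definition concave_on (R : realType) (E : lmodType R) (A : set E) (g : E -> R) :
    Prop :=
  convex_function A (fun z => - g z).

Definition space_dir (R : realType) (n : nat) (i : 'I_n) : 'rV[R]_n * R :=
  (delta_mx 0 i, 0).

Definition time_dir (R : realType) (n : nat) : 'rV[R]_n * R := (0, 1).

Definition dx (R : realType) (n : nat) (i : 'I_n) (u : 'rV[R]_n * R -> R) :
    'rV[R]_n * R -> R :=
  fun z => 'D_(space_dir R i) u z.

Definition dt (R : realType) (n : nat) (u : 'rV[R]_n * R -> R) :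
    'rV[R]_n * R -> R :=
  fun z => 'D_(time_dir R n) u z.

Definition laplacian (R : realType) (n : nat) (u : 'rV[R]_n * R -> R) :
    'rV[R]_n * R -> R :=
  fun z => \sum_(i < n) dx i (dx i u) z.

(* C^{2,1}(D) for open D: two derivatives in x and one in t, all continuous.
   Derivatives are total functions, so their existence is required apart. *)
Definition C21 (R : realType) (n : nat) (D : set ('rV[R]_n * R))
    (u : 'rV[R]_n * R -> R) : Prop :=
  [/\ {within D, continuous u},
      forall i : 'I_n,
        (forall z, D z -> derivable u z (space_dir R i)) /\
        {within D, continuous (dx i u)},
      forall i j : 'I_n,
        (forall z, D z -> derivable (dx i u) z (space_dir R j)) /\
        {within D, continuous (dx j (dx i u))} &
      (forall z, D z -> derivable u z (time_dir R n)) /\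
      {within D, continuous (dt u)}].

(* q / (1 + 2 q), with its limit 1 / 2 at q = +oo. *)
Definition concavity_exponent (R : realType) (q : \bar R) : \bar R :=
  match q with
  | r%:E => (r / (1 + 2 * r))%:E
  | _ => (2^-1)%:E
  end.

(* Main.v *)
Require Import Defs.
From HB Require Import structures.
From mathcomp Require Import all_boot all_order all_algebra.
From mathcomp Require Import ring lra.
From mathcomp Require Import all_classical all_reals all_analysis.

Set Implicit Arguments.
Unset Strict Implicit.
Unset Printing Implicit Defensive.

Import Order.TTheory GRing.Theory Num.Theory.
Import numFieldNormedType.Exports.

Local Open Scope classical_set_scope.
Local Open Scope ring_scope.

(* In the variables (x, s) with t = s^2, the case alpha = 1/2 says that u(x, s^2)^p is
   concave; larger alpha follows because u is nondecreasing in t.  Fix the weight and let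
   the mean of u at two points exceed u at the middle point.  If u vanishes at one of the
   two points, parabolic rescaling about that point turns u into a supersolution,
   precisely because 1/p = 2 + 1/q, and comparison excludes this; no regularity of
   the boundary is needed.  Otherwise perturb u at the middle point by eps t and take
   a positive maximum of the difference, which is interior.  The first-order
   conditions in space and time and the second-order condition along suitably scaled
   directions give
     f(x_l) + eps <= (1 - l) a^(3 - 1/p) f(x1) + l b^(3 - 1/p) f(x2)
   for some weights with (1 - l) a + l b = 1, contrary to Hoelder's inequality and the
   q-concavity of f. *)

(** * Tests in one variable *)

Section OneVariable.
Context {R : realType}.
Implicit Types (g h : R -> R) (x d c : R).

Lemma nbhs_ballR x (P : set R) : (\forall y \near x, P y) ->
  exists2 e : R, 0 < e & forall y, `|x - y| < e -> P y.
Proof. by move=> /nbhs_ballP[e /= e0 eP]; exists e. Qed.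

Lemma is_derive_growth_gt0 g x d : is_derive x 1 g d -> 0 < d ->
  exists2 e : R, 0 < e &
    forall k, k != 0 -> `|k| < e -> 0 < k^-1 * (g (x + k) - g x).
Proof.
case=> dg dgE d0.
have : h^-1 *: ((g \o shift x) (h *: 1) - g x) @[h --> 0^'] --> d.
  by rewrite -dgE; exact: dg.
move=> /cvgr_gt/(_ _ d0); rewrite near_withinE => /nbhs_ballR[e e0 eP].
exists e => // k k0 ke; have := eP k; rewrite /= sub0r normrN ke => /(_ isT k0).
by rewrite /= [k%:A]mulr1 [k + x]addrC.
Qed.

(** The test is one-sided so that it also applies at the final time of a slab, where later times are
    out of reach. *)
Lemma left_max_derive_ge0 g x d : is_derive x 1 g d ->
  (\forall y \near x, y <= x -> g y <= g x) -> 0 <= d.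
Proof.
move=> dg /nbhs_ballR[e e0 gmax]; rewrite leNgt; apply/negP => d0.
have /is_derive_growth_gt0[|r r0 gr] : is_derive x 1 (- g) (- d).
  exact: is_deriveN.
  by rewrite oppr_gt0.
pose k := - (Num.min e r / 2).
have er0 : 0 < Num.min e r by rewrite lt_min e0.
have k0 : k < 0 by rewrite /k oppr_lt0 divr_gt0.
have [ke kr] : `|k| < e /\ `|k| < r.
  apply/andP; rewrite -lt_min /k normrN ger0_norm; last by lra.
  by lra.
have := gr k (ltr0_neq0 k0) kr; rewrite nmulr_rgt0 ?invr_lt0//.
have := gmax (x + k); rewrite opprD addrA subrr sub0r normrN => /(_ ke).
have -> : x + k <= x by lra.
move=> /(_ isT); rewrite !fctE; lra.
Qed.

Lemma max_derive_eq0 g x d : is_derive x 1 g d ->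
  (\forall y \near x, g y <= g x) -> d = 0.
Proof.
move=> dg gmax; apply/eqP; rewrite eq_le; apply/andP; split; last first.
  by apply: left_max_derive_ge0 dg _; apply: filterS gmax.
(* Reflection in [x] exchanges the two sides and changes the sign of the derivative. *)
have dg' : is_derive x 1 (fun y => g (2 * x - y)) (- d).
  have : is_derive x 1 (fun y => 2 * x - y) (-1).
    by apply: is_derive_eq; rewrite add0r mul1r.
  move=> dr; rewrite -mulrN1; apply: is_derive1_comp.
  by rewrite (_ : 2 * x - x = x)//; ring.
rewrite -oppr_ge0; apply: left_max_derive_ge0 dg' _.
have [e e0 eP] := nbhs_ballR gmax.
apply/nbhs_ballP; exists e => //= y xy _.
rewrite (_ : 2 * x - x = x); last by ring.
by apply: eP; rewrite distrC (_ : 2 * x - y - x = x - y)//; ring.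
Qed.

(** A relation that carries the values of both derivatives: [g'] has to be the derivative of [g]
    only near [x], and the calculus rules below compute the values explicitly. *)
Definition twice_derive g x d1 d2 := exists2 g' : R -> R,
  \forall y \near x, is_derive (y : R) (1 : R) g (g' y) & g' x = d1 /\ is_derive x 1 g' d2.

Lemma twice_derive1 g x d1 d2 : twice_derive g x d1 d2 -> is_derive x 1 g d1.
Proof. by case=> g' /nbhs_singleton dg [<-]. Qed.

(** If [d2 > 0], then [g'] vanishes at [x] and is positive just to the right of it, so by the mean
    value theorem [g] exceeds its maximum there. *)
Lemma max_twice_derive_le0 g x d1 d2 : twice_derive g x d1 d2 ->
  (\forall y \near x, g y <= g x) -> d2 <= 0.
Proof.
move=> dg gmax; have d10 := max_derive_eq0 (twice_derive1 dg) gmax.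
case: dg => g' /nbhs_ballR[e1 e10 dg] [g'x dg'].
have [e2 e20 e2P] := nbhs_ballR gmax.
rewrite leNgt; apply/negP => d20.
have [r r0 gr] := is_derive_growth_gt0 dg' d20.
pose m := Num.min r (Num.min e1 e2).
have m0 : 0 < m by rewrite !lt_min r0 e10.
have [mr me1 me2] : [/\ m <= r, m <= e1 & m <= e2].
  by split; rewrite !ge_min lexx ?orbT.
have gc y : y \in `[x, x + m / 2] -> is_derive y 1 g (g' y).
  rewrite in_itv => /= /andP[xy ym]; apply: dg.
  by rewrite ler0_norm; lra.
have xm : x < x + m / 2 by lra.
have gco y : y \in `]x, x + m / 2[ -> is_derive y 1 g (g' y).
  by rewrite in_itv => /= /andP[? ?]; apply: gc; rewrite in_itv/= !ltW.
have gcont : {within `[x, x + m / 2], continuous g}.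
  apply: derivable_within_continuous => y /gc dy; exact: ex_derive.
have [c] := MVT xm gco gcont.
rewrite in_itv => /= /andP[xc cm] gE.
have := gr (c - x); rewrite subr_eq0 gt_eqF// subrKC g'x d10 subr0 => /(_ isT).
rewrite ger0_norm; last by lra.
have -> : c - x < r by lra.
move=> /(_ isT); rewrite pmulr_rgt0 ?invr_gt0 ?subr_gt0// => g'c.
have := e2P (x + m / 2); rewrite ltr0_norm; last by lra.
have -> : - (x - (x + m / 2)) < e2 by lra.
move=> /(_ isT); have : 0 < g' c * (x + m / 2 - x) by rewrite mulr_gt0//; lra.
lra.
Qed.

Lemma twice_deriveD g h x d1 d2 e1 e2 :
  twice_derive g x d1 d2 -> twice_derive h x e1 e2 ->
  twice_derive (fun y => g y + h y) x (d1 + e1) (d2 + e2).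
Proof.
move=> [g' dg [<- dg']] [h' dh [<- dh']]; exists (fun y => g' y + h' y).
  by apply: filterS2 dg dh => y dgy dhy; exact: is_deriveD.
by split=> //; exact: is_deriveD.
Qed.

Lemma twice_deriveZ c g x d1 d2 :
  twice_derive g x d1 d2 -> twice_derive (fun y => c * g y) x (c * d1) (c * d2).
Proof.
move=> [g' dg [<- dg']]; exists (fun y => c * g' y).
  by apply: filterS dg => y dgy; exact: is_deriveZ.
by split=> //; exact: is_deriveZ.
Qed.

Lemma twice_derive_cst c x : twice_derive (fun=> c) x 0 0.
Proof.
exists (fun=> 0); last by split => //; exact: is_derive_cst.
by near=> y; exact: is_derive_cst.
Unshelve. all: by end_near. Qed.

Lemma is_derive_comp_affine g (k b x d : R) : is_derive (k * x + b) 1 g d ->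
  is_derive x 1 (fun y => g (k * y + b)) (k * d).
Proof.
move=> dg; rewrite mulrC; apply: is_derive1_comp.
apply: is_derive_eq; rewrite addr0; exact: mulr1.
Qed.

Lemma twice_derive_comp_affine g (k b x d1 d2 : R) :
  twice_derive g (k * x + b) d1 d2 ->
  twice_derive (fun y => g (k * y + b)) x (k * d1) (k ^+ 2 * d2).
Proof.
move=> [g' dg [<- dg']]; exists (fun y => k * g' (k * y + b)); last first.
  split=> //; rewrite expr2 -mulrA; apply: is_deriveZ.
  exact: is_derive_comp_affine.
have kc : {for x, continuous (fun y : R => k * y + b)}.
  apply: cvgD; last exact: cvg_cst.
  by apply: cvgM; [exact: cvg_cst|exact: cvg_id].
have kdg := kc _ dg; near=> y; apply: is_derive_comp_affine.
  by near: y; exact: kdg.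
Unshelve. all: by end_near. Qed.

(** Powers of order [p - 1] and [p - 2] are written as the [p]-th power divided by [g x] and by its
    square; later computations can then treat the [p]-th power as a separate variable and stay
    rational. *)
Lemma twice_derive_powR g (p x d1 d2 : R) :
  twice_derive g x d1 d2 -> 0 < g x ->
  twice_derive (fun y => g y `^ p) x (p * (g x `^ p / g x) * d1)
    (p * (g x `^ p / g x) * d2 + p * (p - 1) * (g x `^ p / g x ^+ 2) * d1 ^+ 2).
Proof.
move=> dg g0; have dg1 := twice_derive1 dg.
have gpos : \forall y \near x, 0 < g y.
  have : {for x, continuous g}.
    by apply: differentiable_continuous; apply/derivable1_diffP; case: dg1.
  move=> gc; exact: (cvgr_gt _ gc).
case: dg => g' dg [g'x dg'].
have pE a : 0 < a -> a `^ (p - 1) = a `^ p / a.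
  by move=> a0; rewrite powRB ?(gt_eqF a0) ?implybT// powRr1 ?ltW.
have dp q y : 0 < g y -> is_derive y 1 g (g' y) ->
    is_derive y 1 (fun y => g y `^ q) (q * g y `^ (q - 1) * g' y).
  move=> gy dgy.
  exact: (@is_derive1_comp _ (@powR R ^~ q) g y _ _ (is_derive1_powR q gy) dgy).
exists (fun y => p * g y `^ (p - 1) * g' y).
  by apply: filterS2 dg gpos => y dgy gy; exact: dp.
split; first by rewrite pE// g'x.
apply: (@is_derive_eq _ _ _ (fun y => p * g y `^ (p - 1) * g' y)).
  apply: is_deriveM.
  by apply: is_deriveZ; apply: dp => //; rewrite g'x.
rewrite /= -[_ *: _]/(_ * _) -[g' x *: _]/(_ * _) -[p *: _]/(_ * _).
have -> : g x `^ (p - 1 - 1) = g x `^ p / g x ^+ 2.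
  rewrite powRB ?(gt_eqF g0) ?implybT// powRr1 ?ltW// pE//.
  by rewrite -mulrA -invfM.
rewrite pE// g'x; ring.
Qed.

End OneVariable.

(** * Continuity and closures *)

Section Continuity.
Context {R : realType} {T : topologicalType}.

Lemma continuous_pair (U V : topologicalType) (f : T -> U) (g : T -> V) :
  continuous f -> continuous g -> continuous (fun x => (f x, g x)).
Proof. by move=> cf cg x; apply: cvg_pair; [exact: cf|exact: cg]. Qed.

Lemma continuous_compose (U V : topologicalType) (f : U -> V) (g : T -> U) :
  continuous f -> continuous g -> continuous (fun x => f (g x)).
Proof. by move=> cf cg x; apply: continuous_comp; [exact: cg|exact: cf]. Qed.

Lemma continuous_fst_comp (U V : topologicalType) (f : T -> U * V) :
  continuous f -> continuous (fun x => (f x).1).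
Proof. by apply: continuous_compose => x; exact: cvg_fst. Qed.

Lemma continuous_snd_comp (U V : topologicalType) (f : T -> U * V) :
  continuous f -> continuous (fun x => (f x).2).
Proof. by apply: continuous_compose => x; exact: cvg_snd. Qed.

Lemma continuous_add (E : normedModType R) (f g : T -> E) :
  continuous f -> continuous g -> continuous (fun x => f x + g x).
Proof. by move=> cf cg x; apply: cvgD; [exact: cf|exact: cg]. Qed.

Lemma continuous_scale (E : normedModType R) (k : R) (f : T -> E) :
  continuous f -> continuous (fun x => k *: f x).
Proof. by move=> cf x; apply: cvgZ; [exact: cvg_cst|exact: cf]. Qed.

Lemma continuous_mul (f g : T -> R) :
  continuous f -> continuous g -> continuous (fun x => f x * g x).
Proof. by move=> cf cg x; apply: cvgM; [exact: cf|exact: cg]. Qed.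

Lemma continuous_powR (p : R) (f : T -> R) : 0 < p -> (forall x, 0 <= f x) ->
  continuous f -> continuous (fun x => f x `^ p).
Proof.
move=> p0 f0 cf x; have [fx|fx] := eqVneq (f x) 0; last first.
  have fx0 : 0 < f x by rewrite lt_neqAle eq_sym fx f0.
  apply: (@continuous_comp _ _ _ f (@powR R ^~ p) x); first exact: cf.
  apply: differentiable_continuous; apply/derivable1_diffP.
  by case: (is_derive1_powR p fx0).
apply/cvgrPdist_lt => e e0; near=> y; rewrite fx powR0 ?gt_eqF//.
rewrite sub0r normrN ger0_norm ?powR_ge0//.
have -> : e = (e `^ p^-1) `^ p by rewrite -powRrM mulVf ?gt_eqF// powRr1// ltW.
rewrite gt0_ltr_powR ?nnegrE ?powR_ge0//; near: y.
have : f y @[y --> x] --> f x := cf x.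
rewrite fx => /cvgr_lt; apply; exact: powR_gt0.
Unshelve. all: by end_near. Qed.

Lemma closure_preimage (U : topologicalType) (g : T -> U) (A : set T) (B : set U) :
  continuous g -> closed B -> (forall x, A x -> B (g x)) ->
  forall x, closure A x -> B (g x).
Proof.
move=> cg cB AB x Ax.
have cgB : closed (g @^-1` B) by apply: preimage_closed => // y _; exact: cg.
suff : closure (g @^-1` B) x by rewrite -(proj1 (closure_id _) cgB).
exact: closureS Ax.
Qed.

End Continuity.

(** * Comparison principle and heat solutions *)

Section Comparison.
Context {R : realType} {n : nat}.
Implicit Types (w : 'rV[R]_n * R -> R) (Omega : set 'rV[R]_n) (z : 'rV[R]_n * R).

(* Only derivatives along coordinate lines matter: every test below is one-dimensional. *)
Definition heat_jet w z (a : R) (b c : 'I_n -> R) :=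
  is_derive z.2 1 (fun s => w (z.1, s)) a /\
  forall i, twice_derive (fun y => w (z.1 + y *: delta_mx 0 i, z.2)) 0 (b i) (c i).

Lemma compact_slab (M T : R) :
  compact ([set x : 'rV[R]_n | `|x| <= M] `*` `[0, T]).
Proof.
apply: compact_setX; last exact: segment_compact.
apply: bounded_closed_compact.
  by exists M; split; [exact: num_real|move=> N MN x /= /le_trans; apply; exact: ltW].
rewrite -[X in closed X]/((fun x : 'rV[R]_n => `|x|) @^-1` [set r | r <= M]).
by apply: preimage_closed; [move=> x _; exact: norm_continuous|exact: closed_le].
Qed.

(** A weak minimum principle: after adding [eps * t], a negative minimum over a slab contradicts the
    differential inequality. As [w] is nonnegative at every point off the cylinder, such a minimum
    lies inside. *)
Lemma parabolic_comparison Omega (M : R) w :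
  (forall x, Omega x -> `|x| <= M) -> continuous w ->
  (forall z, ~ cylinder Omega z -> 0 <= w z) ->
  (forall z, cylinder Omega z ->
     exists a b c, heat_jet w z a b c /\ \sum_i c i <= a) ->
  forall z, 0 <= w z.
Proof.
move=> OmegaM cw w_off w_heat z0; rewrite leNgt; apply/negP => wz0.
have inD z : w z < 0 -> cylinder Omega z.
  by move=> wz; apply: contrapT => /w_off; rewrite leNgt wz.
have [/OmegaM z0M /= T0] := inD _ wz0.
pose T := z0.2.
have [eps eps0 epsE] : exists2 eps, 0 < eps & w z0 + eps * T < 0.
  exists (- w z0 / (2 * T)); first by rewrite divr_gt0 ?oppr_gt0// mulr_gt0.
  rewrite (_ : _ + _ = w z0 / 2); last by field; rewrite gt_eqF.
  lra.
pose g z := w z + eps * z.2.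
have gz0 : g z0 < 0 by [].
have cg : continuous g.
  move=> z; apply: cvgD; first exact: cw.
  by apply: cvgM; [exact: cvg_cst|exact: cvg_snd].
have z0K : ([set x : 'rV[R]_n | `|x| <= M] `*` `[0, T]) z0.
  by split => //=; rewrite in_itv/= (ltW T0) lexx.
have [[x t] /[!inE] -[/= xM]] := compact_EVT_min (ex_intro _ _ z0K)
  (@compact_slab M T) (continuous_subspaceT cg).
rewrite in_itv/= => /andP[t0 tT] gmin.
have gxt : g (x, t) < 0.
  by apply: le_lt_trans gz0; apply: gmin; rewrite inE.
(* The minimum is global in space: off the cylinder [w], hence [g], is nonnegative, while
   [g (x, t) < 0]. *)
have {}gmin y s : 0 <= s <= T -> g (x, t) <= g (y, s).
  move=> s0T; have [wys|wys] := leP 0 (w (y, s)).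
    apply: (le_trans (ltW gxt)); rewrite addr_ge0 ?mulr_ge0 ?(ltW eps0)//=.
    by case/andP: s0T.
  apply: gmin; rewrite inE; split => /=; last by rewrite in_itv/= s0T.
  by have [/OmegaM] := inD _ wys.
have wxt : w (x, t) < 0.
  apply: le_lt_trans gxt; rewrite lerDl mulr_ge0 ?(ltW eps0)//.
have Dxt := inD _ wxt; have [a [b [c [[/= jt jx] cP]]]] := w_heat _ Dxt.
have [_ /= {}t0] := Dxt.
have c0 i : 0 <= c i.
  rewrite -oppr_le0 -mulN1r.
  apply: (max_twice_derive_le0 (twice_deriveZ (-1) (jx i))).
  near=> y; rewrite scale0r addr0 !mulN1r lerN2.
  have := gmin (x + y *: delta_mx 0 i) t; rewrite (ltW t0) tT => /(_ isT).
  by rewrite /g/= lerD2r.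
have : 0 <= - (a + eps).
  apply: (@left_max_derive_ge0 _ (fun s => - (w (x, s) + eps * s)) t).
    apply: is_deriveN; apply: is_deriveD => //.
    by rewrite -[eps in is_derive _ _ _ eps]mulr1; apply: is_deriveZ.
  near=> s => st; rewrite lerN2; apply: (gmin x s).
  rewrite (le_trans st tT) andbT; apply: ltW; near: s; exact: lt_nbhsr.
have : 0 <= \sum_i c i by apply: sumr_ge0.
lra.
Unshelve. all: by end_near. Qed.

(** Here [u] lives on all of space-time, and its vanishing off the cylinder encodes lateral and
    initial data at once; rescaled copies of [u] can then be compared without tracking their
    domains. *)
Definition heat_solution Omega (f : 'rV[R]_n -> R) u :=
  [/\ continuous u, forall z, ~ cylinder Omega z -> u z = 0 &
      forall z, cylinder Omega z -> exists a b c,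
        heat_jet u z a b c /\ a = \sum_i c i + f z.1].

Section Solution.
Variables (Omega : set 'rV[R]_n) (M : R) (f : 'rV[R]_n -> R) (u : 'rV[R]_n * R -> R).
Hypothesis Omega_bnd : forall x, Omega x -> `|x| <= M.
Hypothesis Omega_convex : forall x y (l : R), Omega x -> Omega y -> 0 < l <= 1 ->
  Omega ((1 - l) *: x + l *: y).
Hypothesis f_ge0 : forall x, Omega x -> 0 <= f x.
Hypothesis u_sol : heat_solution Omega f u.

Lemma heat_solution_ge0 z : 0 <= u z.
Proof.
case: u_sol => cu u_off u_heat.
apply: (parabolic_comparison Omega_bnd cu) => [y /u_off->//|y Dy].
have [a [b [c [jet aE]]]] := u_heat _ Dy; exists a, b, c.
by split=> //; rewrite aE lerDl; apply: f_ge0; case: Dy.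
Qed.

(** The change of variables maps the cylinder into itself by convexity, and parabolic scaling
    multiplies the heat operator by [l ^+ 2]. The bound on [f] thus makes the rescaled function a
    supersolution; off the cylinder it is nonnegative while [u] vanishes. *)
Lemma heat_solution_le_rescaled (x0 : 'rV[R]_n) (l h k : R) :
  Omega x0 -> 0 < l <= 1 -> 0 <= h -> 0 <= k ->
  (forall x, Omega x -> f x <= k * l ^+ 2 * f ((1 - l) *: x0 + l *: x)) ->
  forall x t, u (x, t) <= k * u ((1 - l) *: x0 + l *: x, l ^+ 2 * t + h).
Proof.
move=> Ox0 l01 h0 k0 fk x1 t1; case: (u_sol) => cu u_off u_heat.
pose phi (z : 'rV[R]_n * R) := ((1 - l) *: x0 + l *: z.1, l ^+ 2 * z.2 + h).
pose w z := k * u (phi z) + -1 * u z.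
suff /(_ (x1, t1)) : forall z, 0 <= w z by rewrite /w /phi /= mulN1r subr_ge0.
have cphi : continuous phi.
  have cid : continuous (id : 'rV[R]_n * R -> _) by move=> z; exact: cvg_id.
  apply: continuous_pair; apply: continuous_add.
  - by move=> z; exact: cvg_cst.
  - exact/continuous_scale/continuous_fst_comp.
  - by apply: (continuous_scale (E := R)); exact: continuous_snd_comp.
  - by move=> z; exact: cvg_cst.
apply: (parabolic_comparison Omega_bnd) => [|z Dz|[x t] Dz].
- apply: continuous_add; apply: (continuous_scale (E := R)) => //.
  exact: continuous_compose.
- by rewrite /w (u_off _ Dz) mulr0 addr0 mulr_ge0// heat_solution_ge0.
have [/= Ox t0] := Dz.
have Dphi : cylinder Omega (phi (x, t)).
  split => /=; first exact: Omega_convex.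
  by rewrite ltr_wpDr// mulr_gt0// exprn_gt0//; case/andP: l01.
have [a [b [c [[/= jt jx] aE]]]] := u_heat _ Dz.
have [a' [b' [c' [[/= jt' jx'] a'E]]]] := u_heat _ Dphi.
exists (k * (l ^+ 2 * a') + -1 * a), (fun i => k * (l * b' i) + -1 * b i),
  (fun i => k * (l ^+ 2 * c' i) + -1 * c i); split; first split => [|i] /=.
- by apply: is_deriveD; apply: is_deriveZ => //; exact: is_derive_comp_affine.
- apply: twice_deriveD; apply: twice_deriveZ; last exact: jx.
  rewrite (_ : (fun y => _) = (fun y => u ((1 - l) *: x0 + l *: x +
      (l * y + 0) *: delta_mx 0 i, l ^+ 2 * t + h))); last first.
    by apply/funext => y; rewrite /phi/= addr0 scalerDr scalerA addrA.
  apply: (@twice_derive_comp_affine R (fun y => u ((1 - l) *: x0 + l *: x +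
      y *: delta_mx 0 i, l ^+ 2 * t + h)) l 0 0).
  by rewrite mulr0 addr0; exact: jx'.
rewrite big_split/= -!mulr_sumr aE a'E.
have := fk _ Ox; lra.
Qed.

(** As [f] does not depend on time, this is the rescaling comparison with [l = k = 1], a mere time
    shift. *)
Lemma heat_solution_nondecreasing x t h : 0 <= h -> u (x, t) <= u (x, t + h).
Proof.
move=> h0; case: (u_sol) => _ u_off _.
have [Ox|nOx] := pselect (Omega x); last first.
  by rewrite (u_off (x, t)) ?heat_solution_ge0// => -[].
have := @heat_solution_le_rescaled x 1 h 1 Ox; rewrite ltr01 lexx.
move=> /(_ isT h0 ler01) /(_ _ x t).
rewrite !subrr scale0r add0r scale1r expr1n !mul1r; apply.
by move=> y _; rewrite add0r scale1r mul1r.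
Qed.

Lemma heat_solution_dt_ge0 z a b c : heat_jet u z a b c -> 0 <= a.
Proof.
move=> [jt _]; apply: (left_max_derive_ge0 jt); near=> s => sz.
by rewrite -[z.2](subrK s) addrC heat_solution_nondecreasing// subr_ge0.
Unshelve. all: by end_near. Qed.

End Solution.
End Comparison.

(** * Derivative tests at three points *)

Section ThreePointTest.
Context {R : realType}.

(** One outer time moves and the middle time follows at rate [l1]; the term of the other outer point
    is frozen in [C]. At the contact the difference is maximal from the left, so its derivative
    [l1 * p * (y1 / u1 * g' - Y / K * k')] is nonnegative. *)
Lemma three_point_time (p l1 s y1 C u1 K Y g' k' : R) (g k : R -> R) (sig : R) :
  0 < p -> 0 < l1 -> 0 < u1 -> 0 < K -> y1 = u1 `^ p -> Y = K `^ p ->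
  g s = u1 -> k sig = K -> is_derive s 1 g g' -> is_derive sig 1 k k' ->
  l1 * y1 + C = Y ->
  (\forall r \near s, r <= s ->
     l1 * g r `^ p + C <= k (sig + l1 * (r - s)) `^ p) ->
  Y / K * k' <= y1 / u1 * g'.
Proof.
move=> p0 l0 u0 K0 y1E YE gs ks dg dk YC near_le.
have dpow (h : R -> R) x h' : 0 < h x -> is_derive x 1 h h' ->
    is_derive x 1 (fun r => h r `^ p) (p * (h x `^ p / h x) * h').
  move=> hx dh; apply: is_derive_eq.
    exact: (@is_derive1_comp _ (@powR R ^~ p) h x _ _ (is_derive1_powR p hx) dh).
  by rewrite powRB ?(gt_eqF hx) ?implybT// powRr1// ltW.
have dk' : is_derive s 1 (fun r => k (l1 * r + (sig - l1 * s))) (l1 * k').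
  by apply: is_derive_comp_affine; rewrite addrC subrK.
have dkp := dpow _ s _ _ dk'; rewrite addrC subrK ks in dkp.
have dgp := dpow _ s _ _ dg; rewrite gs in dgp.
have dF : is_derive s 1 (fun r => l1 * g r `^ p + C -
    k (l1 * r + (sig - l1 * s)) `^ p)
    (l1 * (p * (y1 / u1) * g') + 0 - p * (Y / K) * (l1 * k')).
  rewrite y1E YE; apply: is_deriveB; last exact: dkp.
  by apply: is_deriveD; apply: is_deriveZ; exact: dgp.
have : 0 <= l1 * (p * (y1 / u1) * g') + 0 - p * (Y / K) * (l1 * k').
  apply: (left_max_derive_ge0 dF); apply: filterS near_le => r + rs => /(_ rs).
  rewrite gs -y1E YC [l1 * s + _]addrC subrK ks -YE subrr subr_le0.
  by rewrite (_ : l1 * r + _ = sig + l1 * (r - s)) //; ring.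
rewrite addr0 (_ : _ - _ = l1 * p * (y1 / u1 * g' - Y / K * k')); last by ring.
by rewrite pmulr_rge0 ?subr_ge0// mulr_gt0.
Qed.

(* Derivative tests at a contact of [l1 h1^p + l2 h2^p] with [k^p] from below.  Moving
   the two outer points with the speeds [y1 / Y] and [y2 / Y] makes the middle point
   move with speed 1 and makes all squared first derivatives cancel. *)
Lemma three_point_space (p l1 l2 u1 u2 y1 y2 K Y d1 d2 d D1 D2 D : R)
    (h1 h2 k : R -> R) :
  0 < p -> 0 < l1 -> 0 < l2 -> 0 < u1 -> 0 < u2 -> 0 < K ->
  y1 = u1 `^ p -> y2 = u2 `^ p -> Y = K `^ p -> l1 * y1 + l2 * y2 = Y ->
  h1 0 = u1 -> h2 0 = u2 -> k 0 = K ->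
  twice_derive h1 0 d1 D1 -> twice_derive h2 0 d2 D2 -> twice_derive k 0 d D ->
  (forall a b : R, \forall r \near 0,
    l1 * h1 (a * r) `^ p + l2 * h2 (b * r) `^ p
      <= k ((l1 * a + l2 * b) * r) `^ p) ->
  l1 * (y1 / u1 * (y1 / Y) ^+ 2 * D1) + l2 * (y2 / u2 * (y2 / Y) ^+ 2 * D2)
    <= Y / K * D.
Proof.
move=> p0 l10 l20 u10 u20 K0 y1E y2E YE YC h10 h20 k0 dh1 dh2 dk near_le.
have Y0 : 0 < Y by rewrite YE powR_gt0.
have y10 : 0 < y1 by rewrite y1E powR_gt0.
have y20 : 0 < y2 by rewrite y2E powR_gt0.
have dF a b : twice_derive (fun r => l1 * h1 (a * r + 0) `^ p +
    l2 * h2 (b * r + 0) `^ p + -1 * k ((l1 * a + l2 * b) * r + 0) `^ p) 0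
  (l1 * (p * (y1 / u1) * (a * d1)) + l2 * (p * (y2 / u2) * (b * d2)) +
    -1 * (p * (Y / K) * ((l1 * a + l2 * b) * d)))
  (l1 * (p * (y1 / u1) * (a ^+ 2 * D1) +
         p * (p - 1) * (y1 / u1 ^+ 2) * (a * d1) ^+ 2) +
   l2 * (p * (y2 / u2) * (b ^+ 2 * D2) +
         p * (p - 1) * (y2 / u2 ^+ 2) * (b * d2) ^+ 2) +
   -1 * (p * (Y / K) * ((l1 * a + l2 * b) ^+ 2 * D) +
         p * (p - 1) * (Y / K ^+ 2) * ((l1 * a + l2 * b) * d) ^+ 2)).
  have dpow (h : R -> R) c e e' z : 0 < z -> h 0 = z -> twice_derive h 0 e e' ->
      twice_derive (fun r => h (c * r + 0) `^ p) 0 (p * (z `^ p / z) * (c * e))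
        (p * (z `^ p / z) * (c ^+ 2 * e') +
         p * (p - 1) * (z `^ p / z ^+ 2) * (c * e) ^+ 2).
    move=> z0 hz dh; have dh' : twice_derive (fun r => h (c * r + 0)) 0
        (c * e) (c ^+ 2 * e').
      by apply: twice_derive_comp_affine; rewrite mulr0 addr0.
    have := twice_derive_powR p dh'; rewrite mulr0 addr0 hz; exact.
  rewrite y1E y2E YE.
  by apply: twice_deriveD; [apply: twice_deriveD|]; apply: twice_deriveZ; apply: dpow.
have maxF a b : \forall r \near 0, l1 * h1 (a * r + 0) `^ p +
    l2 * h2 (b * r + 0) `^ p + -1 * k ((l1 * a + l2 * b) * r + 0) `^ p
    <= l1 * h1 (a * 0 + 0) `^ p +
    l2 * h2 (b * 0 + 0) `^ p + -1 * k ((l1 * a + l2 * b) * 0 + 0) `^ p.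
  apply: filterS (near_le a b) => r.
  by rewrite !mulr0 !addr0 h10 h20 k0 -y1E -y2E -YE YC !mulN1r subrr subr_le0.
(* Moving one outer point at a time equates [y1 / u1 * d1] and [y2 / u2 * d2] with [Y / K * d]. *)
have e1 := max_derive_eq0 (twice_derive1 (dF 1 0)) (maxF 1 0).
have e2 := max_derive_eq0 (twice_derive1 (dF 0 1)) (maxF 0 1).
have d1E : d1 = Y / K * d / (y1 / u1).
  have : l1 * p * (y1 / u1 * d1 - Y / K * d) = 0 by rewrite -[RHS]e1; ring.
  move=> /eqP; rewrite mulf_eq0 gt_eqF ?mulr_gt0//= subr_eq0 => /eqP <-.
  by field; rewrite !gt_eqF.
have d2E : d2 = Y / K * d / (y2 / u2).
  have : l2 * p * (y2 / u2 * d2 - Y / K * d) = 0 by rewrite -[RHS]e2; ring.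
  move=> /eqP; rewrite mulf_eq0 gt_eqF ?mulr_gt0//= subr_eq0 => /eqP <-.
  by field; rewrite !gt_eqF.
have := max_twice_derive_le0 (dF (y1 / Y) (y2 / Y)) (maxF _ _).
have -> : l1 * (y1 / Y) + l2 * (y2 / Y) = 1.
  by rewrite !mulrA -mulrDl YC divff// gt_eqF.
rewrite expr1n !mul1r mulN1r.
(* By the first-order equations the two terms on the left are [l1 * y1] and [l2 * y2] times
   [d ^+ 2 / K ^+ 2]. This removes all terms with the factor [p - 1], whatever its sign. *)
have cancel : l1 * (y1 / u1 ^+ 2 * (y1 / Y * d1) ^+ 2) +
    l2 * (y2 / u2 ^+ 2 * (y2 / Y * d2) ^+ 2) = Y / K ^+ 2 * d ^+ 2.
  transitivity ((l1 * y1 + l2 * y2) / K ^+ 2 * d ^+ 2); last by rewrite YC.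
  by rewrite d1E d2E; field; rewrite !gt_eqF.
set second := (X in X <= 0 -> _) => second_le0.
have : p * (l1 * (y1 / u1 * (y1 / Y) ^+ 2 * D1) +
    l2 * (y2 / u2 * (y2 / Y) ^+ 2 * D2) - Y / K * D) <= 0.
  rewrite (_ : p * _ = second - p * (p - 1) *
    (l1 * (y1 / u1 ^+ 2 * (y1 / Y * d1) ^+ 2) +
     l2 * (y2 / u2 ^+ 2 * (y2 / Y * d2) ^+ 2) - Y / K ^+ 2 * d ^+ 2)).
    by rewrite cancel subrr mulr0 subr0.
  rewrite /second; ring.
by rewrite pmulr_rle0// subr_le0.
Qed.

(* Cauchy-Schwarz for [sum li * (yi / Y) = 1] and [sum li * si / sig = 1], linearized as
   [a^2 * sig / s >= 2 * a - s / sig]. *)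
Lemma three_point_contradiction (l1 l2 s1 s2 sig y1 y2 u1 u2 K Y
    al1 al2 be L1 L2 L f1 f2 fl eps : R) :
  0 < l1 -> 0 < l2 -> l1 + l2 = 1 -> 0 < s1 -> 0 < s2 ->
  sig = l1 * s1 + l2 * s2 -> 0 < u1 -> 0 < u2 -> 0 < K ->
  0 < y1 -> 0 < y2 -> Y = l1 * y1 + l2 * y2 -> 0 <= be -> 0 < eps ->
  Y / K * (sig * be) <= y1 / u1 * (s1 * al1) ->
  Y / K * (sig * be) <= y2 / u2 * (s2 * al2) ->
  l1 * (y1 / u1 * (y1 / Y) ^+ 2 * L1) + l2 * (y2 / u2 * (y2 / Y) ^+ 2 * L2)
    <= Y / K * L ->
  al1 = L1 + f1 -> al2 = L2 + f2 -> be = L + fl + eps ->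
  l1 * ((y1 / Y) ^+ 3 * (K / u1) * f1) + l2 * ((y2 / Y) ^+ 3 * (K / u2) * f2)
    <= fl -> False.
Proof.
move=> l10 l20 l12 s10 s20 sigE u10 u20 K0 y10 y20 YE be0 eps0 T1 T2 XL A1 A2 BE F.
have Y0 : 0 < Y by rewrite YE addr_gt0// mulr_gt0.
have sig0 : 0 < sig by rewrite sigE addr_gt0// mulr_gt0.
have a12 : l1 * (y1 / Y) + l2 * (y2 / Y) = 1.
  by rewrite !mulrA -mulrDl -YE divff// gt_eqF.
have X' : l1 * ((y1 / Y) ^+ 3 * (K / u1) * L1) +
    l2 * ((y2 / Y) ^+ 3 * (K / u2) * L2) <= L.
  have KY0 : 0 < K / Y by rewrite divr_gt0.
  have := ler_wpM2l (ltW KY0) XL.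
  have -> : K / Y * (Y / K * L) = L by field; rewrite !gt_eqF.
  by apply: le_trans; rewrite le_eqVlt (_ : _ == _) //; apply/eqP; field; rewrite !gt_eqF.
have T' l y v s al : 0 < l -> 0 < s -> 0 < v -> 0 < y ->
    Y / K * (sig * be) <= y / v * (s * al) ->
    l * (2 * (y / Y) - s / sig) * be <= l * ((y / Y) ^+ 3 * (K / v) * al).
  move=> l0 s0 v0 y0 T.
  have c0 : 0 < (y / Y) ^+ 2 * (K / Y) / s.
    by rewrite divr_gt0// mulr_gt0 ?divr_gt0// exprn_gt0// divr_gt0.
  rewrite -mulrA ler_wpM2l ?(ltW l0)//.
  have := ler_wpM2l (ltW c0) T.
  have -> : (y / Y) ^+ 2 * (K / Y) / s * (y / v * (s * al)) =
     (y / Y) ^+ 3 * (K / v) * al by field; rewrite !gt_eqF.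
  apply: le_trans.
  have -> : (y / Y) ^+ 2 * (K / Y) / s * (Y / K * (sig * be)) =
     (y / Y) ^+ 2 * sig / s * be by field; rewrite !gt_eqF.
  rewrite ler_wpM2r// -subr_ge0.
  have -> : (y / Y) ^+ 2 * sig / s - (2 * (y / Y) - s / sig) =
     sig / s * (y / Y - s / sig) ^+ 2 by field; rewrite !gt_eqF.
  by rewrite mulr_ge0 ?sqr_ge0// divr_ge0// ltW.
have := T' l1 y1 u1 s1 al1 l10 s10 u10 y10 T1.
have := T' l2 y2 u2 s2 al2 l20 s20 u20 y20 T2.
have S1 : l1 * (s1 / sig) + l2 * (s2 / sig) = 1.
  by rewrite !mulrA -mulrDl -sigE divff// gt_eqF.
have : l1 * (2 * (y1 / Y) - s1 / sig) * be + l2 * (2 * (y2 / Y) - s2 / sig) * be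
    = be.
  transitivity ((2 * (l1 * (y1 / Y) + l2 * (y2 / Y)) -
    (l1 * (s1 / sig) + l2 * (s2 / sig))) * be); first by ring.
  by rewrite a12 S1; ring.
(* The lower bounds add up to [be], whereas [X'] and [F] bound the same sum by [L + fl], that is, by
   [be - eps]. *)
rewrite A1 A2 !mulrDr; lra.
Qed.

End ThreePointTest.

(** * Parabolic power concavity *)

Lemma is_derive_sqr {R : realType} (s : R) :
  is_derive s 1 (fun r : R => r ^+ 2) (2 * s).
Proof.
have -> : 2 * s = s *: 1 + s *: 1 by rewrite -[s *: 1]/(s * 1); ring.
exact: (is_deriveM (is_derive_id s 1) (is_derive_id s 1)).
Qed.

Section PowerConcavity.
Context {R : realType} {n : nat}.
Variables (Omega : set 'rV[R]_n) (M : R) (f : 'rV[R]_n -> R) (u : 'rV[R]_n * R -> R).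
Variable p : R.
Hypothesis Omega_open : open Omega.
Hypothesis Omega_bnd : forall x, Omega x -> `|x| <= M.
Hypothesis Omega_convex : forall x y (l : R), Omega x -> Omega y -> 0 < l <= 1 ->
  Omega ((1 - l) *: x + l *: y).
Hypothesis f_ge0 : forall x, Omega x -> 0 <= f x.
Hypothesis u_sol : heat_solution Omega f u.
Hypothesis p0 : 0 < p.
Hypothesis f_concave : forall x1 x2 (l a b : R), Omega x1 -> Omega x2 ->
  0 < l < 1 -> 0 <= a -> 0 <= b -> (1 - l) * a + l * b = 1 ->
  (1 - l) * (a `^ (3 - p^-1) * f x1) + l * (b `^ (3 - p^-1) * f x2)
    <= f ((1 - l) *: x1 + l *: x2).

Let u_ge0 z : 0 <= u z. Proof. exact: (heat_solution_ge0 Omega_bnd f_ge0 u_sol). Qed.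

(* Here the factor [l^(1/p)] and the parabolic rescaling of [u] about [(x1, 0)] fit:
   [f_concave] with [a = 0] makes the rescaled [u] a supersolution. *)
Lemma rescaled_le_of_vertex x1 x2 (s1 s2 l : R) : closure Omega x1 ->
  0 <= s1 -> 0 <= s2 -> 0 < l < 1 ->
  l `^ p^-1 * u (x2, s2 ^+ 2)
    <= u ((1 - l) *: x1 + l *: x2, ((1 - l) * s1 + l * s2) ^+ 2).
Proof.
move=> Ox1 s10 s20 /andP[l0 l1]; have [cu _ _] := u_sol.
(* The vertex [x1] may lie on the boundary, but the rescaling comparison wants it in [Omega]; the
   inequality is closed in the vertex. *)
pose g x := u ((1 - l) *: x + l *: x2, ((1 - l) * s1 + l * s2) ^+ 2).
have cg : continuous g.
  apply: continuous_compose => //.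
  apply: continuous_pair; last exact: cst_continuous.
  apply: continuous_add; last exact: cst_continuous.
  by apply: continuous_scale => x; exact: cvg_id.
set c := l `^ p^-1 * _.
suff gc x : Omega x -> c <= g x by exact: (closure_preimage cg (@closed_ge _ c) gc Ox1).
move=> Ox; rewrite /g /c.
have L0 : 0 < l `^ p^-1 by rewrite powR_gt0.
(* This difference is the time shift [h] of the rescaling comparison; it is nonnegative because
   [(1 - l) * s1] is. *)
have sl : 0 <= ((1 - l) * s1 + l * s2) ^+ 2 - l ^+ 2 * s2 ^+ 2.
  rewrite -exprMn subr_ge0.
  by rewrite ler_pXn2r ?nnegrE ?lerDr ?addr_ge0 ?mulr_ge0 ?subr_ge0 ?(ltW l0) ?(ltW l1).
have := @heat_solution_le_rescaled _ _ Omega M f u Omega_bnd Omega_convex f_ge0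
  u_sol x l _ ((l `^ p^-1)^-1) Ox _ sl _ _ x2 (s2 ^+ 2).
rewrite [_ + (_ - _)]addrC subrK ler_pdivlMl// => -> //.
- by rewrite l0 ltW.
- by rewrite invr_ge0 ltW.
(* With [a = 0] the normalization forces [b = l^-1]. The factor of [f y] becomes [l] to the power
   [1/p - 2], exactly what the parabolic scaling needs. *)
move=> y Oy; have := @f_concave x y l 0 l^-1 Ox Oy.
rewrite l0 l1 mulr0 add0r divff ?gt_eqF// => /(_ isT (lexx 0)).
rewrite invr_ge0 (ltW l0) => /(_ isT erefl).
have -> : l^-1 `^ (3 - p^-1) = l `^ p^-1 / l ^+ 3.
  rewrite -powR_inv1 ?(ltW l0)// -powRrM mulN1r opprB powRB ?(gt_eqF l0) ?implybT//.
  by rewrite powR_mulrn ?(ltW l0).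
move=> H; rewrite -mulrA ler_pdivlMl//.
have := ler_wpM2l (exprn_ge0 2 (ltW l0)) (le_trans _ H).
rewrite (_ : l `^ p^-1 * f y = l ^+ 2 * (l * (l `^ p^-1 / l ^+ 3 * f y))); last first.
  by field; rewrite gt_eqF.
by apply; rewrite lerDr !mulr_ge0 ?powR_ge0 ?f_ge0 ?subr_ge0 ?(ltW l1).
Qed.

Lemma near_line_in x (e : 'rV[R]_n) (a : R) : Omega x ->
  \forall r \near 0, Omega (x + (a * r) *: e).
Proof.
move=> Ox.
have : x + (a * r) *: e @[r --> 0] --> x + (a * 0) *: e.
  apply: cvgD; first exact: cvg_cst.
  apply: cvgZ; last exact: cvg_cst.
  by apply: cvgM; [exact: cvg_cst|exact: cvg_id].
by rewrite mulr0 scale0r addr0; apply; exact: open_nbhs_nbhs.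
Qed.

(* In the variables [(x, s)] with [t = s^2]; [eps] makes the middle function a strict
   supersolution, which excludes equality in the concavity of [f]. *)
Lemma no_interior_contact x1 x2 (s1 s2 l S m eps : R) :
  let mean_u (y1 y2 : 'rV[R]_n) (r1 r2 : R) :=
    (1 - l) * u (y1, r1 ^+ 2) `^ p + l * u (y2, r2 ^+ 2) `^ p in
  let v (y1 y2 : 'rV[R]_n) (r1 r2 : R) :=
    u ((1 - l) *: y1 + l *: y2, ((1 - l) * r1 + l * r2) ^+ 2)
    + eps * ((1 - l) * r1 + l * r2) ^+ 2 + m in
  Omega x1 -> Omega x2 -> 0 < s1 <= S -> 0 < s2 <= S -> 0 < l < 1 -> 0 < eps ->
  0 < m -> 0 < u (x1, s1 ^+ 2) -> 0 < u (x2, s2 ^+ 2) ->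
  (forall y1 y2 r1 r2, Omega y1 -> Omega y2 -> 0 <= r1 <= S -> 0 <= r2 <= S ->
     mean_u y1 y2 r1 r2 <= v y1 y2 r1 r2 `^ p) ->
  mean_u x1 x2 s1 s2 = v x1 x2 s1 s2 `^ p -> False.
Proof.
move=> mean_u v Ox1 Ox2 /andP[s10 s1S] /andP[s20 s2S] /andP[l0 l1] eps0 m0 u10 u20.
move=> mean_le mean_eq.
have [cu u_off u_heat] := u_sol.
have k0 : 0 < 1 - l by rewrite subr_gt0.
pose xl := (1 - l) *: x1 + l *: x2; pose sig := (1 - l) * s1 + l * s2.
have Oxl : Omega xl by apply: Omega_convex => //; rewrite l0 ltW.
have sig0 : 0 < sig by rewrite addr_gt0// mulr_gt0.
have K0 : 0 < v x1 x2 s1 s2.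
  by rewrite /v ltr_wpDl// addr_ge0// mulr_ge0 ?(ltW eps0)// sqr_ge0.
have [a1 [b1 [c1 [[/= jt1 jx1] E1]]]] : exists a b c,
    heat_jet u (x1, s1 ^+ 2) a b c /\ a = \sum_i c i + f x1.
  by apply: u_heat; split => //=; rewrite exprn_gt0.
have [a2 [b2 [c2 [[/= jt2 jx2] E2]]]] : exists a b c,
    heat_jet u (x2, s2 ^+ 2) a b c /\ a = \sum_i c i + f x2.
  by apply: u_heat; split => //=; rewrite exprn_gt0.
have [a [b [c [j E]]]] : exists a b c,
    heat_jet u (xl, sig ^+ 2) a b c /\ a = \sum_i c i + f xl.
  by apply: u_heat; split => //=; rewrite exprn_gt0.
have a0 : 0 <= a := heat_solution_dt_ge0 Omega_bnd Omega_convex f_ge0 u_sol j.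
have [/= jt jx] := j.
set u1 := u (x1, s1 ^+ 2) in u10 mean_eq *.
set u2 := u (x2, s2 ^+ 2) in u20 mean_eq *.
set K := v x1 x2 s1 s2 in K0 mean_eq *.
(* The substitution [t = s^2] produces a factor [2 * s]: [half] removes the 2, and [s] stays in the
   time tests. *)
have dsq (x : 'rV[R]_n) (s d : R) : is_derive (s ^+ 2 : R) (1 : R) (fun t => u (x, t)) d ->
    is_derive s 1 (fun r => u (x, r ^+ 2)) (2 * (s * d)).
  move=> du.
  have := @is_derive1_comp _ (fun t => u (x, t)) (fun r => r ^+ 2) s _ _
    du (is_derive_sqr s).
  by rewrite (_ : d * (2 * s) = 2 * (s * d)) //; ring.
have dk : is_derive sig 1 (fun r => u (xl, r ^+ 2) + eps * r ^+ 2 + m)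
    (2 * (sig * (a + eps))).
  have ds : is_derive sig 1 (fun r : R => eps * r ^+ 2) (eps * (2 * sig)).
    by apply: is_deriveZ; exact: is_derive_sqr.
  have := is_deriveD (is_deriveD (dsq _ _ _ jt) ds) (is_derive_cst m sig 1).
  by rewrite (_ : _ + 0 = 2 * (sig * (a + eps))) //; ring.
have half (A B y z : R) : A * (2 * y) <= B * (2 * z) -> A * y <= B * z.
  by rewrite mulrCA [leRHS]mulrCA ler_pM2l.
have T1 : K `^ p / K * (sig * (a + eps)) <= u1 `^ p / u1 * (s1 * a1).
  apply: half; apply: (@three_point_time _ p (1 - l) s1 _ (l * u2 `^ p) u1 K _ _ _
    (fun r => u (x1, r ^+ 2)) (fun r => u (xl, r ^+ 2) + eps * r ^+ 2 + m) sig
    p0 k0 u10 K0 erefl erefl erefl erefl (dsq _ _ _ jt1) dk mean_eq).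
  near=> r => rs; have := mean_le x1 x2 r s2 Ox1 Ox2.
  rewrite (le_trans rs s1S) (ltW s20) s2S andbT /v.
  rewrite -/xl (_ : (1 - l) * r + l * s2 = sig + (1 - l) * (r - s1)); last first.
    by rewrite /sig; ring.
  by apply=> //; apply: ltW; near: r; exact: lt_nbhsr.
have T2 : K `^ p / K * (sig * (a + eps)) <= u2 `^ p / u2 * (s2 * a2).
  apply: half; apply: (@three_point_time _ p l s2 _ ((1 - l) * u1 `^ p) u2 K _ _ _
    (fun r => u (x2, r ^+ 2)) (fun r => u (xl, r ^+ 2) + eps * r ^+ 2 + m) sig
    p0 l0 u20 K0 erefl erefl erefl erefl (dsq _ _ _ jt2) dk); first by rewrite addrC.
  near=> r => rs; rewrite [leLHS]addrC; have := mean_le x1 x2 s1 r Ox1 Ox2.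
  rewrite (le_trans rs s2S) (ltW s10) s1S !andbT /v.
  rewrite -/xl (_ : (1 - l) * s1 + l * r = sig + l * (r - s2)); last first.
    by rewrite /sig; ring.
  by apply=> //; apply: ltW; near: r; exact: lt_nbhsr.
(* In the space test the times are fixed, so the perturbation and [m] are constants and leave the
   second derivatives alone. As [Omega] is open, short moves of the outer points are admissible. *)
have X i : (1 - l) * (u1 `^ p / u1 * (u1 `^ p / K `^ p) ^+ 2 * c1 i) +
    l * (u2 `^ p / u2 * (u2 `^ p / K `^ p) ^+ 2 * c2 i) <= K `^ p / K * c i.
  have jk : twice_derive (fun r => u (xl + r *: delta_mx 0 i, sig ^+ 2) +
      (eps * sig ^+ 2 + m)) 0 (b i) (c i).
    by have := twice_deriveD (jx i) (twice_derive_cst (eps * sig ^+ 2 + m) 0);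
      rewrite !addr0.
  apply: (three_point_space p0 k0 l0 u10 u20 K0 erefl erefl erefl mean_eq _ _ _
    (jx1 i) (jx2 i) jk); rewrite ?scale0r ?addr0//.
    by rewrite addrA.
  move=> d e; near=> r.
  have := mean_le (x1 + (d * r) *: delta_mx 0 i) (x2 + (e * r) *: delta_mx 0 i) s1 s2.
  rewrite (ltW s10) s1S (ltW s20) s2S /v -/sig addrA.
  rewrite (_ : (1 - l) *: _ + _ = xl + (((1 - l) * d + l * e) * r) *: delta_mx 0 i).
    by apply=> //; near: r; exact: near_line_in.
  by rewrite /xl !scalerDr !scalerA addrACA -scalerDl; congr (_ + _ *: _); ring.
(* The [p]-th root of [y^p / z^p] is [y / z], so the coefficients in [three_point_contradiction] are
   the powers of order [3 - 1/p] from [f_concave]. *)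
have coef y z : 0 < y -> 0 < z ->
    (y `^ p / z `^ p) `^ (3 - p^-1) = (y `^ p / z `^ p) ^+ 3 * (z / y).
  move=> y0 z0; have yz : 0 < y `^ p / z `^ p by rewrite divr_gt0// powR_gt0.
  rewrite powRB ?(gt_eqF yz) ?implybT// powR_mulrn ?(ltW yz)//; congr (_ * _).
  have -> : y `^ p / z `^ p = (y / z) `^ p.
    rewrite powRM ?invr_ge0 ?(ltW y0) ?(ltW z0)//; congr (_ * _).
    by rewrite -[z^-1](powR_inv1 (ltW z0)) -powRrM mulN1r powRN.
  rewrite -powRrM mulfV ?gt_eqF// powRr1 ?invf_div//.
  by rewrite divr_ge0 ?ltW.
(* These weights are normalized because, by [mean_eq], the mean of the outer [p]-th powers is the
   [p]-th power of [K]. *)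
have F := @f_concave x1 x2 l (u1 `^ p / K `^ p) (u2 `^ p / K `^ p) Ox1 Ox2.
apply: (@three_point_contradiction R (1 - l) l s1 s2 sig (u1 `^ p) (u2 `^ p) u1 u2
  K (K `^ p) a1 a2 (a + eps) (\sum_i c1 i) (\sum_i c2 i) (\sum_i c i)
  (f x1) (f x2) (f xl) eps) => //; try exact: powR_gt0.
- by rewrite subrK.
- by rewrite addr_ge0 ?(ltW eps0).
- rewrite !mulr_sumr -big_split/=; apply: ler_sum => i _; exact: X.
- by rewrite E.
rewrite -!coef//; apply: F; rewrite ?l0//.
- by rewrite divr_ge0 ?powR_ge0.
- by rewrite divr_ge0 ?powR_ge0.
by rewrite !mulrA -mulrDl [X in X / _]mean_eq divff// gt_eqF ?powR_gt0.
Unshelve. all: by end_near. Qed.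

Lemma compact_closure_slab (S : R) : compact (closure Omega `*` `[0, S]).
Proof.
apply: compact_setX; last exact: segment_compact.
apply: bounded_closed_compact; last exact: closed_closure.
exists M; split; first exact: num_real.
move=> N MN x Ox /=; apply: le_trans (ltW MN).
by apply: (closure_preimage (@norm_continuous _ _) (@closed_le _ M) Omega_bnd).
Qed.

(** If one value vanishes, the power mean collapses to a multiple of the other value, the left side
    of [rescaled_le_of_vertex]. The second case exchanges the points, and [l] with [1 - l]. *)
Lemma power_mean_le_of_zero x1 x2 (s1 s2 l : R) : closure Omega x1 ->
  closure Omega x2 -> 0 <= s1 -> 0 <= s2 -> 0 < l < 1 ->
  u (x1, s1 ^+ 2) = 0 \/ u (x2, s2 ^+ 2) = 0 ->
  ((1 - l) * u (x1, s1 ^+ 2) `^ p + l * u (x2, s2 ^+ 2) `^ p) `^ p^-1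
    <= u ((1 - l) *: x1 + l *: x2, ((1 - l) * s1 + l * s2) ^+ 2).
Proof.
move=> Ox1 Ox2 s10 s20 l01; have pn0 : p != 0 by rewrite gt_eqF.
have [l0 l1] := andP l01.
have vertex k z : 0 < k -> (k * u z `^ p) `^ p^-1 = k `^ p^-1 * u z.
  move=> k0; rewrite powRM ?powR_ge0 ?(ltW k0)// -powRrM divff// powRr1//.
move=> [->|->]; rewrite powR0// mulr0 ?add0r ?addr0 vertex ?subr_gt0//.
  exact: rescaled_le_of_vertex.
rewrite [_ *: x1 + _]addrC [_ * s1 + _]addrC.
have := @rescaled_le_of_vertex x2 x1 s2 s1 (1 - l) Ox2 s20 s10.
by rewrite subKr subr_gt0 l1 ltrBlDr ltrDl l0; apply.
Qed.

Lemma parabolic_power_concave x1 x2 (s1 s2 l : R) : closure Omega x1 ->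
  closure Omega x2 -> 0 <= s1 -> 0 <= s2 -> 0 < l < 1 ->
  ((1 - l) * u (x1, s1 ^+ 2) `^ p + l * u (x2, s2 ^+ 2) `^ p) `^ p^-1
    <= u ((1 - l) *: x1 + l *: x2, ((1 - l) * s1 + l * s2) ^+ 2).
Proof.
move=> Ox1 Ox2 s10 s20 l01; have [l0 l1] := andP l01.
have [cu u_off _] := u_sol.
have p'0 : 0 < p^-1 by rewrite invr_gt0.
rewrite leNgt; apply/negP => lt12.
pose mu (z : ('rV[R]_n * R) * ('rV[R]_n * R)) :=
  ((1 - l) * u (z.1.1, z.1.2 ^+ 2) `^ p + l * u (z.2.1, z.2.2 ^+ 2) `^ p) `^ p^-1.
pose sg (z : ('rV[R]_n * R) * ('rV[R]_n * R)) := (1 - l) * z.1.2 + l * z.2.2.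
pose v (z : ('rV[R]_n * R) * ('rV[R]_n * R)) :=
  u ((1 - l) *: z.1.1 + l *: z.2.1, sg z ^+ 2).
pose zeta := ((x1, s1), (x2, s2)).
(* With [d] the defect and [q] the squared middle time, [eps = d / (q + 1)] leaves
   [d - eps * q = eps > 0]. *)
have [eps eps0 epsP] : exists2 eps, 0 < eps &
    0 < mu zeta - (v zeta + eps * sg zeta ^+ 2).
  have d0 : 0 < mu zeta - v zeta by rewrite subr_gt0.
  have q0 : 0 < sg zeta ^+ 2 + 1 by rewrite ltr_wpDl ?sqr_ge0.
  exists ((mu zeta - v zeta) / (sg zeta ^+ 2 + 1)); first by rewrite divr_gt0.
  rewrite opprD addrA subr_gt0 mulrAC ltr_pdivrMr// mulrDr mulr1; lra.
pose Phi z := mu z - (v z + eps * sg z ^+ 2).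
(* Truncation in time makes the set of pairs compact; a maximum at the final time is harmless, since
   the time tests are one-sided. *)
pose S := Num.max s1 s2.
have csg : continuous sg.
  have cid : continuous (id : ('rV[R]_n * R) * ('rV[R]_n * R) -> _).
    by move=> z; exact: cvg_id.
  apply: continuous_add; apply: (continuous_scale (E := R)).
    exact/continuous_snd_comp/continuous_fst_comp.
  exact/continuous_snd_comp/continuous_snd_comp.
have cPhi : continuous Phi.
  have cid : continuous (id : ('rV[R]_n * R) * ('rV[R]_n * R) -> _).
    by move=> z; exact: cvg_id.
  have c11 := continuous_fst_comp (continuous_fst_comp cid).
  have c12 := continuous_snd_comp (continuous_fst_comp cid).
  have c21 := continuous_fst_comp (continuous_snd_comp cid).
  have c22 := continuous_snd_comp (continuous_snd_comp cid).
  have csg2 : continuous (fun z => sg z ^+ 2) by exact: continuous_mul.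
  move=> z; apply: cvgB; move: z.
    apply: continuous_powR => // [z|].
      by rewrite addr_ge0// mulr_ge0 ?powR_ge0 ?subr_ge0 ?(ltW l0) ?(ltW l1).
    have cu1 := continuous_compose cu (continuous_pair c11 (continuous_mul c12 c12)).
    have cu2 := continuous_compose cu (continuous_pair c21 (continuous_mul c22 c22)).
    apply: continuous_add; apply: (continuous_scale (E := R)).
      exact: continuous_powR cu1.
    exact: continuous_powR cu2.
  apply: continuous_add; last exact: (continuous_scale (E := R)).
  apply: continuous_compose => //; apply: continuous_pair => //.
  by apply: continuous_add; apply: continuous_scale.
have zetaK : ((closure Omega `*` `[0, S]) `*` (closure Omega `*` `[0, S])) zeta.
  by split; split => //=; rewrite in_itv/= /S le_max lexx ?orbT ?s10 ?s20.
have [[[y1 r1] [y2 r2]]] := compact_EVT_max (ex_intro _ _ zetaK)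
  (compact_setX (@compact_closure_slab S) (@compact_closure_slab S))
  (continuous_subspaceT cPhi).
rewrite inE /= => -[[/= Oy1 r1S] [/= Oy2 r2S]] maxP.
rewrite !in_itv /= in r1S r2S.
have /andP[r10 r1S'] := r1S; have /andP[r20 r2S'] := r2S.
have [m mE m0] : exists2 m, m = Phi ((y1, r1), (y2, r2)) & 0 < m.
  by eexists; first reflexivity; apply: lt_le_trans epsP _; apply: maxP; rewrite inE.
(* At a vanishing value concavity is already known, so [Phi] would be at most zero. *)
have nz : ~ (u (y1, r1 ^+ 2) = 0 \/ u (y2, r2 ^+ 2) = 0).
  move=> /(power_mean_le_of_zero Oy1 Oy2 r10 r20 l01) le0.
  move: m0; rewrite mE /Phi subr_gt0 ltNge => /negP; apply.
  by apply: (le_trans le0); rewrite lerDl mulr_ge0 ?sqr_ge0 ?(ltW eps0).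
(* As [u] vanishes off the open cylinder, a nonzero value alone places the point in [Omega] and
   after the initial time. *)
have inD y r : 0 <= r -> u (y, r ^+ 2) != 0 ->
    [/\ Omega y, 0 < r & 0 < u (y, r ^+ 2)].
  move=> r0 unz; have [Oy /= rr] : cylinder Omega (y, r ^+ 2).
    by apply: contrapT => /u_off uz; rewrite uz eqxx in unz.
  split=> //; last by rewrite lt_neqAle eq_sym unz u_ge0.
  rewrite lt_neqAle r0 andbT eq_sym; apply: contraTneq rr => ->.
  by rewrite expr0n ltxx.
have [||Oy1' r1pos u1pos] := inD y1 r1 => //.
  by apply/negP => /eqP u0; apply: nz; left.
have [||Oy2' r2pos u2pos] := inD y2 r2 => //.
  by apply/negP => /eqP u0; apply: nz; right.
have X0 (w1 w2 : R) : 0 <= (1 - l) * w1 `^ p + l * w2 `^ p.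
  by rewrite addr_ge0// mulr_ge0 ?powR_ge0 ?subr_ge0 ?(ltW l0) ?(ltW l1).
have XK (w1 w2 : R) : (((1 - l) * w1 `^ p + l * w2 `^ p) `^ p^-1) `^ p =
    (1 - l) * w1 `^ p + l * w2 `^ p.
  by rewrite -powRrM mulVf ?gt_eqF// powRr1.
apply: (@no_interior_contact y1 y2 r1 r2 l S m eps) => //.
- by rewrite r1pos.
- by rewrite r2pos.
- move=> x x' r r' Ox Ox' rS rS'.
  have := maxP ((x, r), (x', r')); rewrite inE /= => le_m.
  rewrite -XK ge0_ler_powR ?nnegrE ?powR_ge0 ?(ltW p0)//.
    apply: addr_ge0 (ltW m0); apply: addr_ge0 => //.
    by rewrite mulr_ge0 ?sqr_ge0 ?(ltW eps0).
  rewrite -lerBlDl mE; apply: le_m.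
  by split; split => //=; rewrite ?in_itv/= //; exact: subset_closure.
- by rewrite -XK; congr (_ `^ _); rewrite mE /Phi /mu /v /sg /= [RHS]addrC subrK.
Qed.

End PowerConcavity.

(** * Power means and closed cylinders *)

Section PowerMeans.
Context {R : realType}.

(** Hoelder's inequality with exponents [r] and [r / (r - 1)], after each weight has been split into
    its powers of order [1 - 1/r] and [1/r]; by normalization the factor with [a] and [b] is 1. For
    [r = 1] both sides agree. *)
Lemma weighted_le_power_mean (r l a b f1 f2 : R) : 1 <= r -> 0 < l < 1 ->
  0 <= a -> 0 <= b -> 0 <= f1 -> 0 <= f2 -> (1 - l) * a + l * b = 1 ->
  (1 - l) * (a `^ (1 - r^-1) * f1) + l * (b `^ (1 - r^-1) * f2)
    <= ((1 - l) * f1 `^ r + l * f2 `^ r) `^ r^-1.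
Proof.
move=> r1 /andP[l0 l1] a0 b0 f10 f20 ab.
have k0 : 0 < 1 - l by rewrite subr_gt0.
have r0 : 0 < r by apply: lt_le_trans r1.
have [->|rn1] := eqVneq r 1.
  rewrite invr1 subrr !powRr0 !mul1r !powRr1// addr_ge0// mulr_ge0// ltW//.
have {}r1 : 1 < r by rewrite lt_neqAle eq_sym rn1.
have r'0 : 0 < 1 - r^-1 by rewrite subr_gt0 invf_lt1.
pose s := (1 - r^-1)^-1.
have s0 : 0 < s by rewrite invr_gt0.
have split_term k x f' : 0 < k -> 0 <= x -> 0 <= f' ->
    k * (x `^ (1 - r^-1) * f') = ((k * x) `^ (1 - r^-1)) * (k `^ r^-1 * f').
  move=> kk0 x0 f'0; rewrite powRM ?(ltW kk0)//.
  have kE : k = k `^ (1 - r^-1) * k `^ r^-1.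
    by rewrite -powRD ?(gt_eqF kk0) ?implybT// subrK powRr1// ltW.
  rewrite {1}kE; ring.
rewrite !split_term//.
have := @hoelder2 _ (((1 - l) * a) `^ (1 - r^-1)) ((l * b) `^ (1 - r^-1))
  ((1 - l) `^ r^-1 * f1) (l `^ r^-1 * f2) s r.
rewrite !powR_ge0 !mulr_ge0 ?powR_ge0// => /(_ isT isT isT isT s0 r0).
rewrite {1}/s invrK subrK => /(_ erefl) /le_trans; apply.
rewrite -!powRrM /s mulfV ?gt_eqF// !powRr1 ?mulr_ge0 ?(ltW l0) ?(ltW k0)// ab.
rewrite powR1 mul1r !powRM ?powR_ge0// -!powRrM mulVf ?gt_eqF//.
by rewrite !powRr1 ?(ltW l0) ?(ltW k0).
Qed.

(** Jensen's inequality for the power of order [2 * a >= 1], applied to the square roots. *)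
Lemma sqrt_mean_le_power_mean (a t1 t2 l : R) : 2^-1 <= a -> 0 <= t1 -> 0 <= t2 ->
  0 < l < 1 ->
  ((1 - l) * Num.sqrt t1 + l * Num.sqrt t2) ^+ 2
    <= ((1 - l) * t1 `^ a + l * t2 `^ a) `^ a^-1.
Proof.
move=> a12 t10 t20 /andP[l0 l1].
have a0 : 0 < a by apply: lt_le_trans a12; rewrite invr_gt0.
have k0 : 0 < 1 - l by rewrite subr_gt0.
have p1 : 1 <= 2 * a by lra.
have sq t : 0 <= t -> Num.sqrt t `^ (2 * a) = t `^ a.
  by move=> t0; rewrite powRrM powR_mulrn ?sqrtr_ge0// sqr_sqrtr.
have le_p : ((1 - l) * Num.sqrt t1 + l * Num.sqrt t2) `^ (2 * a)
    <= (1 - l) * t1 `^ a + l * t2 `^ a.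
  rewrite -(sq t1)// -(sq t2)// ![(1 - l) * _ + _]addrC.
  apply: (@convex_powR R (2 * a) p1 (Itv01 (ltW l0) (ltW l1))
    (Num.sqrt t2) (Num.sqrt t1)); by rewrite inE /= in_itv /= sqrtr_ge0.
have sig0 : 0 <= (1 - l) * Num.sqrt t1 + l * Num.sqrt t2.
  by rewrite addr_ge0// mulr_ge0 ?sqrtr_ge0 ?(ltW l0) ?(ltW k0).
have -> : ((1 - l) * Num.sqrt t1 + l * Num.sqrt t2) ^+ 2 =
    (((1 - l) * Num.sqrt t1 + l * Num.sqrt t2) `^ (2 * a)) `^ a^-1.
  by rewrite -powRrM mulfK ?gt_eqF// powR_mulrn.
have mean0 : 0 <= (1 - l) * t1 `^ a + l * t2 `^ a.
  by rewrite addr_ge0// mulr_ge0 ?powR_ge0 ?(ltW l0) ?(ltW k0).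
apply: ge0_ler_powR le_p; rewrite ?nnegrE ?powR_ge0//.
by rewrite invr_ge0 ltW.
Qed.

Lemma sqrt_mean_le_max (t1 t2 l : R) : 0 <= t1 -> 0 <= t2 -> 0 < l < 1 ->
  ((1 - l) * Num.sqrt t1 + l * Num.sqrt t2) ^+ 2 <= Num.max t1 t2.
Proof.
move=> t10 t20 /andP[l0 l1]; have k0 : 0 < 1 - l by rewrite subr_gt0.
have m0 : 0 <= Num.max t1 t2 by rewrite le_max t10.
rewrite -[leRHS]sqr_sqrtr// ler_pXn2r ?nnegrE ?sqrtr_ge0//; last first.
  by rewrite addr_ge0// mulr_ge0 ?sqrtr_ge0 ?(ltW l0) ?(ltW k0).
have -> : Num.sqrt (Num.max t1 t2) =
    (1 - l) * Num.sqrt (Num.max t1 t2) + l * Num.sqrt (Num.max t1 t2) by ring.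
by rewrite lerD// ler_pM2l// ler_wsqrtr// le_max lexx ?orbT.
Qed.

End PowerMeans.

Section ClosedCylinder.
Context {R : realType} {n : nat}.
Variable Omega : set 'rV[R]_n.

Lemma open_cylinder : open Omega -> open (cylinder Omega).
Proof.
move=> oO; rewrite /cylinder -[X in open X]/((fst @^-1` Omega) `&` (snd @^-1` _)).
apply: openI; first by apply: open_comp => // z _; exact: cvg_fst.
by apply: open_comp; [move=> z _; exact: cvg_snd|exact: open_gt].
Qed.

Lemma closure_cylinder (x : 'rV[R]_n) (t : R) :
  closure (cylinder Omega) (x, t) <-> closure Omega x /\ 0 <= t.
Proof.
split=> [xt|[Ox t0]].
  have cid : continuous (id : 'rV[R]_n * R -> _) by move=> z; exact: cvg_id.
  split.
    apply: (closure_preimage (continuous_fst_comp cid) (@closed_closure _ Omega) _ xt).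
    by move=> z [Oz _]; exact: subset_closure.
  apply: (closure_preimage (continuous_snd_comp cid) (@closed_ge _ 0) _ xt).
  by move=> z [_ t0]; exact: ltW.
pose cD := @closed_closure _ (cylinder Omega).
apply: (@closure_preimage _ _ (fun y => (y, t)) Omega _ _ cD _ x Ox).
  by apply: continuous_pair; [move=> y; exact: cvg_id|exact: cst_continuous].
move=> y Oy; have c : continuous (fun s : R => (y, s)).
  by apply: continuous_pair; [exact: cst_continuous|move=> s; exact: cvg_id].
have yD s : [set r : R | 0 < r] s -> cylinder Omega (y, s) by [].
have tc : closure [set r : R | 0 < r] t by rewrite closure_gt.
exact: (closure_preimage c cD (fun s s0 => @subset_closure _ _ _ (yD s s0)) tc).
Qed.

Lemma closure_convex :
  (forall x y (l : R), Omega x -> Omega y -> 0 < l <= 1 ->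
     Omega ((1 - l) *: x + l *: y)) ->
  forall x y (l : R), closure Omega x -> closure Omega y -> 0 < l <= 1 ->
     closure Omega ((1 - l) *: x + l *: y).
Proof.
move=> cvx x y l Ox Oy l01; have cO := @closed_closure _ Omega.
have cid : continuous (id : 'rV[R]_n -> _) by move=> z; exact: cvg_id.
have c1 z : continuous (fun w : 'rV[R]_n => (1 - l) *: w + l *: z : 'rV[R]_n).
  by apply: continuous_add; [exact: continuous_scale|exact: cst_continuous].
have c2 : continuous (fun z : 'rV[R]_n => (1 - l) *: x + l *: z : 'rV[R]_n).
  by apply: continuous_add; [exact: cst_continuous|exact: continuous_scale].
have O1 z w : Omega z -> Omega w -> closure Omega ((1 - l) *: w + l *: z).
  by move=> Oz Ow; apply: subset_closure; exact: cvx.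
have O2 z (Oz : Omega z) : closure Omega ((1 - l) *: x + l *: z) :=
  closure_preimage (c1 z) cO (fun w => O1 z w Oz) Ox.
exact: (closure_preimage c2 cO O2 Oy).
Qed.

End ClosedCylinder.

(** * Extension by zero *)

Section ZeroExtension.
Context {R : realType} {n : nat}.
Variables (Omega : set 'rV[R]_n) (f : 'rV[R]_n -> R) (u : 'rV[R]_n * R -> R).
Hypothesis Omega_open : open Omega.
Hypothesis u_C21 : C21 (cylinder Omega) u.
Hypothesis u_cont : {within closure (cylinder Omega), continuous u}.
Hypothesis u_heat : forall z, cylinder Omega z -> dt u z = laplacian u z + f z.1.
Hypothesis u_bdry : forall z, boundary (cylinder Omega) z -> u z = 0.

(* Extending by zero makes [u] continuous on all of space-time. *)
Definition zero_extension (z : 'rV[R]_n * R) : R :=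
  if `[< cylinder Omega z >] then u z else 0.

Lemma zero_extension_in z : cylinder Omega z -> zero_extension z = u z.
Proof. by move=> Dz; rewrite /zero_extension asboolT. Qed.

Lemma zero_extension_out z : ~ cylinder Omega z -> zero_extension z = 0.
Proof. by move=> Dz; rewrite /zero_extension asboolF. Qed.

Lemma boundary_cylinder z : closure (cylinder Omega) z -> ~ cylinder Omega z ->
  boundary (cylinder Omega) z.
Proof. by move=> cDz nDz; split=> // /interior_subset. Qed.

Lemma zero_extension_closure z : closure (cylinder Omega) z -> zero_extension z = u z.
Proof.
move=> cDz; have [/zero_extension_in//|nDz] := pselect (cylinder Omega z).
by rewrite zero_extension_out// u_bdry//; exact: boundary_cylinder.
Qed.

(** Inside the open cylinder the function agrees with [u] nearby; at a boundary point [u] tends to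
    zero within the closure and the values elsewhere are zero; at an exterior point the function
    vanishes nearby. *)
Lemma continuous_zero_extension : continuous zero_extension.
Proof.
move=> z; have [Dz|nDz] := pselect (cylinder Omega z).
  have [uc _ _ _] := u_C21.
  rewrite continuous_open_subspace in uc; last exact: open_cylinder.
  have near_eq : \forall y \near z, u y = zero_extension y.
    have : \forall y \near z, cylinder Omega y.
      by apply: open_nbhs_nbhs; split => //; exact: open_cylinder.
    by apply: filterS => y /zero_extension_in.
  rewrite /continuous_at zero_extension_in//.
  by apply: cvg_trans (uc z (mem_set Dz)); exact: near_eq_cvg.
apply/cvgrPdist_lt => e e0; rewrite (zero_extension_out nDz).
have [cDz|ncDz] := pselect (closure (cylinder Omega) z).
  have uz : u z = 0 by apply: u_bdry; exact: boundary_cylinder.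
  have := proj1 (subspace_continuousP _ _) u_cont z cDz.
  move=> /cvgrPdist_lt/(_ e e0); rewrite near_withinE; apply: filterS => y.
  rewrite /from_subspace uz.
  have [Dy|nDy] := pselect (cylinder Omega y).
    by rewrite zero_extension_in//; apply; exact: subset_closure.
  by rewrite zero_extension_out// subrr normr0.
have : \forall y \near z, (~` closure (cylinder Omega)) y.
  apply: open_nbhs_nbhs; split => //; apply: closed_openC; exact: closed_closure.
apply: filterS => y ncDy; rewrite zero_extension_out ?subrr ?normr0//.
by move=> Dy; apply: ncDy; exact: subset_closure.
Qed.

Lemma is_derive_line (g : 'rV[R]_n * R -> R) (z v : 'rV[R]_n * R) (s : R) :
  derivable g (z + s *: v) v ->
  is_derive s 1 (fun y => g (z + y *: v)) ('D_v g (z + s *: v)).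
Proof.
move=> dg.
have E : (fun h : R => h^-1 *: (((fun y => g (z + y *: v)) \o shift s) (h *: 1) -
      g (z + s *: v))) =
    (fun h : R => h^-1 *: ((g \o shift (z + s *: v)) (h *: v) - g (z + s *: v))).
  apply/funext => h /=; congr (_ *: (g _ - _)).
  by rewrite [h%:A]mulr1 scalerDl [RHS]addrCA.
by split; [rewrite /derivable E|rewrite /derive E].
Qed.

Lemma heat_jet_zero_extension z : cylinder Omega z ->
  heat_jet zero_extension z (dt u z) (fun i => dx i u z) (fun i => dx i (dx i u) z).
Proof.
move=> Dz; have [_ ux uxx [ut _]] := u_C21.
have line_in (v y : 'rV[R]_n * R) (s : R) : cylinder Omega (y + s *: v) ->
    \forall r \near s, cylinder Omega (y + r *: v).
  move=> Dy; have c : (y + r *: v) @[r --> s] --> y + s *: v.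
    apply: cvgD; first exact: cvg_cst.
    by apply: cvgZ; [exact: cvg_id|exact: cvg_cst].
  by apply: c; apply: open_nbhs_nbhs; split => //; exact: open_cylinder.
have dline (v y : 'rV[R]_n * R) (s : R) : cylinder Omega (y + s *: v) ->
    derivable u (y + s *: v) v ->
    is_derive s 1 (fun r => zero_extension (y + r *: v)) ('D_v u (y + s *: v)).
  move=> Dy du; apply: near_eq_is_derive (is_derive_line du).
  by apply: filterS (line_in _ _ _ Dy) => r /zero_extension_in.
split=> [|i].
  (* The line is based at time 0, so that its parameter is the time itself, as in [heat_jet]. *)
  have -> : (fun s => zero_extension (z.1, s)) =
      (fun s => zero_extension ((z.1, 0) + s *: time_dir R n)).
    apply/funext => s; congr zero_extension.
    by apply/pair_equal_spec; rewrite /= scaler0 addr0 add0r [s%:A]mulr1.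
  have zE : z = (z.1, 0) + z.2 *: time_dir R n.
    case: z {Dz} => x t; apply/pair_equal_spec.
    by rewrite /= scaler0 addr0 add0r [t%:A]mulr1.
  have := dline (time_dir R n) (z.1, 0) z.2; rewrite -zE => /(_ Dz); apply.
  exact: ut.
have -> : (fun y => zero_extension (z.1 + y *: delta_mx 0 i, z.2)) =
    (fun y => zero_extension (z + y *: space_dir R i)).
  apply/funext => s; congr zero_extension; apply/pair_equal_spec.
  by rewrite /= scaler0 addr0.
have z0 : z + 0 *: space_dir R i = z by rewrite scale0r addr0.
exists (fun y => dx i u (z + y *: space_dir R i)).
  have := line_in (space_dir R i) z 0; rewrite z0 => /(_ Dz).
  by apply: filterS => y Dy; apply: dline => //; exact: (ux i).1.
split; first by rewrite z0.
have := @is_derive_line (dx i u) z (space_dir R i) 0.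
by rewrite z0; apply; exact: (uxx i i).1.
Qed.

Lemma heat_solution_zero_extension : heat_solution Omega f zero_extension.
Proof.
split; [exact: continuous_zero_extension|exact: zero_extension_out|].
move=> z Dz; exists (dt u z), (fun i => dx i u z), (fun i => dx i (dx i u) z).
by split; [exact: heat_jet_zero_extension|exact: u_heat].
Qed.

End ZeroExtension.

(** * Passage to the means of the statement, and conclusion *)

Lemma pconcave_weighted (R : realType) (n : nat) (Omega : set 'rV[R]_n)
    (f : 'rV[R]_n -> R) (q : \bar R) : (1%:E <= q)%E -> pconcave q Omega f ->
  exists2 p : R, 0 < p /\ concavity_exponent q = p%:E &
  forall x1 x2 (l a b : R), Omega x1 -> Omega x2 ->
    0 < l < 1 -> 0 <= a -> 0 <= b -> (1 - l) * a + l * b = 1 ->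
    (1 - l) * (a `^ (3 - p^-1) * f x1) + l * (b `^ (3 - p^-1) * f x2)
      <= f ((1 - l) *: x1 + l *: x2).
Proof.
case: q => [r|_ [f_ge0 f_conc]|//].
  rewrite lee_fin => r1 [f_ge0 f_conc].
  have r0 : 0 < r by apply: lt_le_trans r1.
  exists (r / (1 + 2 * r)).
    by split => //; rewrite divr_gt0// addr_gt0// mulr_gt0.
  move=> x1 x2 l a b Ox1 Ox2 l01 a0 b0 ab.
  (* Since [1/p = 2 + 1/r], the exponent of the weights is the one of Hoelder's inequality. *)
  have -> : 3 - (r / (1 + 2 * r))^-1 = 1 - r^-1.
    by field; rewrite !gt_eqF//= addr_gt0// mulr_gt0.
  have := f_conc _ _ _ Ox1 Ox2 l01.
  rewrite /= gt_eqF// ltNge (ltW r0)/= => /(le_trans _); apply.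
  exact: weighted_le_power_mean (f_ge0 _ Ox1) (f_ge0 _ Ox2) ab.
(* For [q = +oo] the exponent [3 - 1/p] is 1, and the left side is a convex combination of the two
   values of [f], at most their maximum. *)
exists 2^-1; first by split.
move=> x1 x2 l a b Ox1 Ox2 l01 a0 b0 ab; have /andP[l0 l1] := l01.
rewrite invrK (_ : 3 - 2 = 1); last by ring.
rewrite !powRr1//; apply: le_trans (f_conc _ _ _ Ox1 Ox2 l01).
have -> : pmean +oo%E (f x1) (f x2) l = (1 - l) * (a * Num.max (f x1) (f x2)) +
    l * (b * Num.max (f x1) (f x2)) by rewrite !mulrA -mulrDl ab mul1r.
by apply: lerD; do 2 (apply: ler_wpM2l; first by rewrite ?subr_ge0 // ltW);
  rewrite le_max lexx ?orbT.
Qed.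

Lemma pmeanE (R : realType) (p a b l : R) : 0 < p ->
  pmean p%:E a b l = ((1 - l) * a `^ p + l * b `^ p) `^ p^-1.
Proof. by move=> p0; rewrite /= gt_eqF// ltNge (ltW p0). Qed.

(** Here the bound [alpha >= 1/2] enters: the time mean of order [alpha] dominates that of order
    1/2, which is the square on the left. *)
Lemma sqrt_mean_le_pmean (R : realType) (alpha : \bar R) (t1 t2 l : R) :
  ((2^-1)%:E <= alpha)%E -> 0 <= t1 -> 0 <= t2 -> 0 < l < 1 ->
  ((1 - l) * Num.sqrt t1 + l * Num.sqrt t2) ^+ 2 <= pmean alpha t1 t2 l.
Proof.
case: alpha => [a|_|//]; last exact: sqrt_mean_le_max.
rewrite lee_fin => a12 t10 t20 l01; rewrite pmeanE; last first.
  by apply: lt_le_trans a12; rewrite invr_gt0.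
exact: sqrt_mean_le_power_mean.
Qed.

Lemma convex_set_segment (R : realType) (n : nat) (Omega : set 'rV[R]_n) :
  convex_set Omega -> forall x y (l : R), Omega x -> Omega y -> 0 < l <= 1 ->
  Omega ((1 - l) *: x + l *: y).
Proof.
move=> cvx x y l Ox Oy /andP[l0 l1].
have := cvx y x (Itv01 (ltW l0) l1) (mem_set Oy) (mem_set Ox).
by rewrite inE addrC.
Qed.

Theorem theorem1p2 (R : realType) (n : nat) (n_ge1 : (1 <= n)%N)
  (Omega : set 'rV[R]_n) (Omega_dom : convex_domain Omega)
  (Omega_bnd : bounded_set Omega)
  (f : 'rV[R]_n -> R) (f_ge0 : forall x, Omega x -> 0 <= f x)
  (u : 'rV[R]_n * R -> R)
  (u_C21 : C21 (cylinder Omega) u)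
  (u_cont : {within closure (cylinder Omega), continuous u})
  (u_heat : forall z, cylinder Omega z -> dt u z = laplacian u z + f z.1)
  (u_bdry : forall z, boundary (cylinder Omega) z -> u z = 0) :
  (forall q : \bar R, (1%:E <= q)%E -> pconcave q Omega f ->
     forall alpha : \bar R, ((2^-1)%:E <= alpha)%E ->
       parabolically_pconcave alpha (concavity_exponent q)
         (closure (cylinder Omega)) u)
  /\
  (forall c : R, 0 < c -> (forall x, Omega x -> f x = c) ->
     forall alpha : R, 2^-1 <= alpha ->
       concave_on (closure (cylinder Omega))
         (fun z => Num.sqrt (u (z.1, z.2 `^ alpha^-1)))).
Proof.
have [_ Oopen /convex_set_segment Ocvx] := Omega_dom.
have [M OM] : exists M, forall x, Omega x -> `|x| <= M.
  by have [N [_ NP]] := Omega_bnd; exists (N + 1); apply: NP; rewrite ltrDl.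
have ub_sol := heat_solution_zero_extension Oopen u_C21 u_cont u_heat u_bdry.
have ub_ge0 := heat_solution_ge0 OM f_ge0 ub_sol.
have ubE := zero_extension_closure u_bdry.
have u_ge0 z : closure (cylinder Omega) z -> 0 <= u z by move=> /ubE <-.
have part1 q : (1%:E <= q)%E -> pconcave q Omega f ->
    forall alpha, ((2^-1)%:E <= alpha)%E ->
    parabolically_pconcave alpha (concavity_exponent q)
      (closure (cylinder Omega)) u.
  move=> q1 f_conc alpha alpha12; split=> // x1 t1 x2 t2 l D1 D2 l01.
  have [p [p0 ->] f_weighted] := pconcave_weighted q1 f_conc.
  have [Ox1 t10] := (closure_cylinder _ _ _).1 D1.
  have [Ox2 t20] := (closure_cylinder _ _ _).1 D2.
  have l01' : 0 < l <= 1 by case/andP: l01 => -> /ltW.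
  have sqrt_le := sqrt_mean_le_pmean alpha12 t10 t20 l01.
  have D : closure (cylinder Omega)
      ((1 - l) *: x1 + l *: x2, pmean alpha t1 t2 l).
    apply/closure_cylinder; split; first exact: closure_convex.
    exact: le_trans (sqr_ge0 _) sqrt_le.
  rewrite pmeanE// -!ubE//.
  have := parabolic_power_concave Oopen OM Ocvx f_ge0 ub_sol p0 f_weighted Ox1 Ox2
    (sqrtr_ge0 t1) (sqrtr_ge0 t2) l01.
  rewrite !sqr_sqrtr// => /le_trans; apply.
  (* The middle time for order 1/2 is at most the one for [alpha]; monotonicity of [u] in time
     bridges the gap. *)
  rewrite -subr_ge0 in sqrt_le.
  have := heat_solution_nondecreasing OM Ocvx f_ge0 ub_sol
    ((1 - l) *: x1 + l *: x2)
    (((1 - l) * Num.sqrt t1 + l * Num.sqrt t2) ^+ 2) sqrt_le.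
  by rewrite [_ ^+ 2 + _]addrC subrK.
split=> // c c0 fc alpha alpha12.
have a0 : 0 < alpha by apply: lt_le_trans alpha12; rewrite invr_gt0.
have /part1 : (1%:E <= +oo :> \bar R)%E by rewrite leey.
(* A constant is concave even of order [+oo], for which the exponent in the first part is 1/2. *)
have f_conc : pconcave +oo%E Omega f.
  split=> // x y l Ox Oy /andP[l0 l1] /=.
  by rewrite !fc ?maxxx//; apply: Ocvx => //; rewrite l0 ltW.
move=> /(_ f_conc alpha%:E); rewrite lee_fin => /(_ alpha12) [_ u_conc].
move=> l [x1 t1] [x2 t2] /set_mem D1 /set_mem D2.
(* [convex_function] also covers the weights 0 and 1, which the means exclude. *)
have [->|ln0] := eqVneq l 0%:i01; first by rewrite !conv0.
have [->|ln1] := eqVneq l 1%:i01; first by rewrite !conv1.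
have l0 : 0 < l%:num by rewrite lt_neqAle eq_sym ln0 ge0.
have l1 : l%:num < 1 by rewrite lt_neqAle ln1 le1.
have [Ox1 t10] := (closure_cylinder _ _ _).1 D1.
have [Ox2 t20] := (closure_cylinder _ _ _).1 D2.
have Dpow x t : closure Omega x -> closure (cylinder Omega) (x, t `^ alpha^-1).
  by move=> Ox; apply/closure_cylinder; split; rewrite ?powR_ge0.
have l01 : 0 < l%:num < 1 by rewrite l0.
(* At times of the form [t^(1/alpha)] the mean of order [alpha] is the [1/alpha]-th power of the
   arithmetic mean of the [t]. The points are exchanged because [conv] puts the weight [l] on its
   first argument. *)
have := u_conc _ _ _ _ _ (Dpow x2 t2 Ox2) (Dpow x1 t1 Ox1) l01.
have powK t : 0 <= t -> (t `^ alpha^-1) `^ alpha = t.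
  by move=> t0; rewrite -powRrM mulVf ?gt_eqF// powRr1.
rewrite /concavity_exponent !pmeanE ?invr_gt0// !powK// invrK.
rewrite powR_mulrn ?addr_ge0 ?mulr_ge0 ?powR_ge0 ?subr_ge0 ?(ltW l0) ?(ltW l1)//.
have u1_ge0 := u_ge0 _ (Dpow x1 t1 Ox1).
have u2_ge0 := u_ge0 _ (Dpow x2 t2 Ox2).
(* The mean of order 1/2 is the square of the mean of the square roots, so taking roots yields
   ordinary concavity. *)
rewrite !powR12_sqrt// => u_le.
rewrite (_ : conv l ((x1, t1) : convex_lmodType ('rV[R]_n * R)%type) (x2, t2) =
  ((1 - l%:num) *: x2 + l%:num *: x1,
  (1 - l%:num) * t2 + l%:num * t1)); last first.
  by apply/pair_equal_spec; split; rewrite /= addrC.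
rewrite -convN lerN2 convRE /= [leLHS]addrC.
have := ler_wsqrtr u_le; rewrite sqrtr_sqr ger0_norm; first exact.
by rewrite addr_ge0// mulr_ge0 ?sqrtr_ge0 ?subr_ge0 ?(ltW l0) ?(ltW l1).
Qed.
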